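(* Let $L$ be a fourth order linear differential equation in the complex variable $z$ with rational coefficients and regular singularities, having a point of maximally unipotent monodromy, whose projective monodromy group $\Gamma$ is a subgroup of $\mathrm{Sp}_4(\mathbb R)$ commensurable with a discrete subgroup of $\mathrm{Sp}_4(\mathbb Z)$. Let $u_0,u_1,u_2,u_3$ be a basis of solutions such that $W(u_0,u_2)+W(u_1,u_3)=0$ and such that analytic continuation along any loop acts on the column vector $(u_3,u_2,u_1,u_0)^{T}$ (and simultaneously on $(u_3',u_2',u_1',u_0')^T$) by left multiplication by a matrix $\gamma\in\Gamma$. Fix $\kappa\neq0$ and put $w_{jl}=\kappa\,W(u_j,u_l)=\kappa(u_ju_l'-u_j'u_l)$ for $0\le j,l\le 3$, where $'=\mathrm d/\mathrm dz$. Put $\tau_1=w_{03}/w_{01}$, $\tau_2=w_{02}/w_{01}$, $\tau_3=-w_{12}/w_{01}$ and $\mathrm T=\begin{pmatrix}\tau_1&\tau_2\\ \tau_2&\tau_3\end{pmatrix}$, so that for $\gamma=\begin{pmatrix}A&B\\ C&D\end{pmatrix}\in\Gamma$ (with $2\times 2$ blocks) continuation along the corresponding loop sends $\mathrm T$ to $\gamma\mathrm T=(A\mathrm T+B)(C\mathrm T+D)^{-1}$. Then the inverse $z=z(\mathrm T(\tau))$ of the (multivalued) map $\tau=\tau_1(z)$ is a $\Gamma$-modular form of weight $0$, and the function $w_{01}$, viewed as a function of $\mathrm T=\mathrm T(\tau)$, is a $\Gamma$-modular form of weight $1$; that is, $z(\gamma\mathrm T)=z(\mathrm T)$ and $w_{01}(\gamma\mathrm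 T)=\det(C\mathrm T+D)\,w_{01}(\mathrm T)$ for all $\gamma=\begin{pmatrix}A&B\\ C&D\end{pmatrix}\in\Gamma$.
   Context: $W(f,g)=fg'-f'g$ denotes the Wronskian. A function $f(\mathrm T(\tau))$ is called a $\Gamma$-modular form of weight $k$ if $f(\gamma\mathrm T)=\det(C\mathrm T+D)^k f(\mathrm T)$ for all $\gamma=\begin{pmatrix}A&B\\ C&D\end{pmatrix}\in\Gamma$, where $f(\gamma\mathrm T)$ means the analytic continuation of $f$ along the loop corresponding to $\gamma$. *)

(* Defs.v *)
From HB Require Import structures.
From mathcomp Require Export all_boot all_order all_algebra complex.
From mathcomp Require Export all_classical all_reals all_analysis.
Export Order.TTheory GRing.Theory Num.Theory numFieldNormedType.Exports.

Set Implicit Arguments.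
Unset Strict Implicit.
Unset Printing Implicit Defensive.

#[export] Set Implicit Arguments.
#[export] Unset Strict Implicit.
#[export] Unset Printing Implicit Defensive.

Global Open Scope classical_set_scope.
Global Open Scope complex_scope.
Global Open Scope ring_scope.

(* The topology of R[i] is only inferred for a term of the form
   [NumField.sort _], hence this packaged version. *)
Definition Cx (R : realType) : numFieldType := R[i].

Section AnalyticContinuation.
Variable R : realType.
Local Notation C := (Cx R).
Implicit Types (f g : C -> C) (p : R -> C) (z : C).

Definition has_pseries f z : Prop :=
  exists a : nat -> C, exists2 r : C, 0 < r &
    forall x, `|x - z| < r ->
      series (fun n => a n * (x - z) ^+ n) @ \oo --> f x.

Definition analytic_at f z : Prop := \forall x \near z, has_pseries f x.

Definition germ_eq z f g : Prop := \forall x \near z, f x = g x.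

(* [F t] is the function element carried by the point [p t]; [f] and [g] only
   matter through their germs at [p 0] and [p 1]. *)
Definition continuation p f g : Prop :=
  exists F : R -> C -> C,
    [/\ forall t : R, t \in `[0, 1] -> analytic_at (F t) (p t),
        forall t : R, t \in `[0, 1] ->
          \forall s \near t, s \in `[0, 1] -> germ_eq (p s) (F s) (F t),
        germ_eq (p 0) f (F 0)
      & germ_eq (p 1) (F 1) g].

Definition loop_avoiding (S : set C) (b : C) (l : R -> C) : Prop :=
  [/\ {within `[0, 1], continuous l}, l 0 = b, l 1 = b
    & forall t : R, t \in `[0, 1] -> ~ S (l t)].

Definition circle (s q : C) (t : R) : C :=
  s + (q - s) * (cos (2 * pi * t) +i* sin (2 * pi * t)).

Definition continues_by p (V : C -> 'cV[C]_(2 + 2)) (M : 'M[C]_(2 + 2)) : Prop :=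
  forall i, continuation p (fun x => V x i 0) (fun x => (M *m V x) i 0).

Definition local_inverse (b : C) (tau zeta : C -> C) : Prop :=
  [/\ analytic_at zeta (tau b),
      \forall x \near b, zeta (tau x) = x
    & \forall t \near tau b, tau (zeta t) = t].

End AnalyticContinuation.

(* Rational functions in lowest terms: the poles are the roots of [rf_den] and
   their orders are the multiplicities of these roots. *)
Record ratfun (F : fieldType) := RatFun {
  rf_num : {poly F};
  rf_den : {poly F};
  rf_den_neq0 : rf_den != 0;
  rf_coprime : coprimep rf_num rf_den }.

Definition rf_eval (F : fieldType) (a : ratfun F) (z : F) : F :=
  (rf_num a).[z] / (rf_den a).[z].

Section FourthOrderEquation.
Variable R : realType.
Local Notation C := (Cx R).

(* [L] encodes  y'''' + sum_(i < 4) L_i y^(i) = 0. *)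
Implicit Type L : 'I_4 -> ratfun C.

Definition singular L : set C := [set z | exists i, root (rf_den (L i)) z].

(* Fuchs' conditions: L_i has a pole of order at most 4 - i at every finite
   point, and z^(4 - i) L_i is bounded at infinity. *)
Definition regular_singularities L : Prop :=
  (forall z i, (mup z (rf_den (L i)) <= 4 - i)%N) /\
  (forall i, rf_num (L i) != 0 ->
     (size (rf_num (L i)) + (4 - i) <= size (rf_den (L i)))%N).

Definition solution L (z : C) (f : C -> C) : Prop :=
  analytic_at f z /\
  \forall x \near z,
    derive1n 4 f x + \sum_(i < 4) rf_eval (L i) x * derive1n i f x = 0.

Definition solution_basis L (z : C) (v : 'I_4 -> C -> C) : Prop :=
  [/\ forall i, solution L z (v i),
      forall c : 'I_4 -> C,
        (\forall x \near z, \sum_i c i * v i x = 0) -> forall i, c i = 0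
    & forall f, solution L z f ->
        exists c : 'I_4 -> C, \forall x \near z, f x = \sum_i c i * v i x].

Definition colvec (v : 'I_4 -> C -> C) (x : C) : 'cV[C]_(2 + 2) :=
  \col_i v (rev_ord i) x.

Definition max_unipotent (N : 'M[C]_(2 + 2)) : Prop :=
  (N - 1%:M) ^+ 4 = 0 /\ (N - 1%:M) ^+ 3 <> 0.

Definition mum_along L (s q : C) : Prop :=
  exists v, solution_basis L q v /\
  exists2 N, continues_by (circle s q) (colvec v) N & max_unipotent N.

(* In the first case the circle encloses the finite point [s] and no other
   singular point; in the second one it encloses all the finite singular
   points, i.e. it is a loop around the point at infinity. *)
Definition has_mum_point L : Prop :=
  (exists s q : C, [/\ q <> s,
      forall x, `|x - s| <= `|q - s| -> singular L x -> x = s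
    & mum_along L s q]) \/
  (exists q : C, [/\ q <> 0, forall x, singular L x -> `|x| < `|q|
    & mum_along L 0 q]).

End FourthOrderEquation.

Section SymplecticGroups.
Variable R : realType.
Local Notation M4 := 'M[R]_(2 + 2).
Implicit Types (G H : set M4).

Definition symp_form : M4 := block_mx 0 1%:M (- 1%:M) 0.

Definition Sp4 : set M4 := [set g | g^T *m symp_form *m g = symp_form].

Definition Sp4Z : set M4 :=
  Sp4 `&` [set g | forall i j, g i j \is a Num.int].

Definition subgroup_of G H : Prop :=
  [/\ G `<=` H, G 1%:M, forall g h, G g -> G h -> G (g *m h)
    & forall g, G g -> G (invmx g)].

Definition finite_index H G : Prop :=
  exists s : seq M4, forall g, G g -> exists2 x, x \in s &
    exists2 h, H h & g = x *m h.

Definition commensurable G H : Prop :=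
  finite_index (G `&` H) G /\ finite_index (G `&` H) H.

Definition discrete_subset G : Prop :=
  forall g, G g -> \forall h \near g, G h -> h = g.

Definition cmx (g : M4) : 'M[Cx R]_(2 + 2) :=
  map_mx (fun r : R => r%:C : Cx R) g.

Definition automorphy_mx (g : M4) (T : 'M[Cx R]_2) : 'M[Cx R]_2 :=
  dlsubmx (cmx g) *m T + drsubmx (cmx g).

Definition moebius (g : M4) (T : 'M[Cx R]_2) : 'M[Cx R]_2 :=
  (ulsubmx (cmx g) *m T + ursubmx (cmx g)) *m invmx (automorphy_mx g T).

End SymplecticGroups.
Arguments Sp4 R : clear implicits.
Arguments Sp4Z R : clear implicits.

Section Modularity.
Variable R : realType.
Local Notation C := (Cx R).
Local Notation M4 := 'M[R]_(2 + 2).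
Implicit Types (L : 'I_4 -> ratfun C) (b : C) (u : 'I_4 -> C -> C).
Implicit Types (Gamma : set M4) (g : M4).

(* Equality of projective classes, that is, up to a nonzero scalar. *)
Definition loop_of L b u g (l : R -> C) : Prop :=
  loop_avoiding (singular L) b l /\
  exists2 c : C, c != 0 & continues_by l (colvec u) (c *: cmx g).

(* [Gamma] has the same image in PGL_4(C) as the group of all monodromy
   matrices with respect to the vector (u_3, u_2, u_1, u_0). *)
Definition projective_monodromy_group L b u Gamma : Prop :=
  (forall l M, loop_avoiding (singular L) b l ->
     continues_by l (colvec u) M ->
     exists2 g, Gamma g & exists2 c : C, c != 0 & M = c *: cmx g) /\
  (forall g, Gamma g -> exists l, loop_of L b u g l).

Definition wronskian (f g : C -> C) (x : C) : C :=
  f x * derive1 g x - derive1 f x * g x.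

Definition wfun (kappa : C) u (j l : 'I_4) (x : C) : C :=
  kappa * wronskian (u j) (u l) x.

Definition tau1 (w : 'I_4 -> 'I_4 -> C -> C) (x : C) : C := w 0 3 x / w 0 1 x.
Definition tau2 (w : 'I_4 -> 'I_4 -> C -> C) (x : C) : C := w 0 2 x / w 0 1 x.
Definition tau3 (w : 'I_4 -> 'I_4 -> C -> C) (x : C) : C := - w 1 2 x / w 0 1 x.

Definition Tmx (w : 'I_4 -> 'I_4 -> C -> C) (x : C) : 'M[C]_2 :=
  \matrix_(i, j) [:: tau1 w x; tau2 w x; tau3 w x]`_(i + j)%N.

(* [f'] is the branch of the function [f] of T that is reached at gamma T when
   f(T(z)) is continued analytically along the loop [l]. *)
Definition branch_along b (T : C -> 'M[C]_2) g (l : R -> C)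
    (f f' : 'M[C]_2 -> C) : Prop :=
  exists2 h, continuation l (fun x => f (T x)) h &
    \forall x \near b, automorphy_mx g (T x) \in unitmx ->
      f' (moebius g (T x)) = h x.

Definition modular_form L b u Gamma (T : C -> 'M[C]_2)
    (f : 'M[C]_2 -> C) (k : int) : Prop :=
  forall g l, Gamma g -> loop_of L b u g l ->
    (exists f', branch_along b T g l f f') /\
    (forall f', branch_along b T g l f f' ->
       \forall x \near b, automorphy_mx g (T x) \in unitmx ->
         f' (moebius g (T x)) = \det (automorphy_mx g (T x)) ^ k * f (T x)).

(* Continuing the w_jl along a loop corresponding to [gamma] turns T into
   gamma T, away from the poles of the latter. *)
Definition T_continues_by_moebius L b u Gamma
    (w : 'I_4 -> 'I_4 -> C -> C) : Prop :=
  forall g l, Gamma g -> loop_of L b u g l ->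
  exists2 w' : 'I_4 -> 'I_4 -> C -> C,
    forall j m, continuation l (w j m) (w' j m) &
    \forall x \near b, w' 0 1 x != 0 ->
      automorphy_mx g (Tmx w x) \in unitmx /\
      Tmx w' x = moebius g (Tmx w x).

End Modularity.

(* Main.v *)
Require Import Defs.
From mathcomp Require Import ring.

(* With the 2x2 blocks P = (u_3 u_3'; u_2 u_2') and Q = (u_1 u_1'; u_0 u_0') one
   has w_01 = - kappa det Q, and the relation W(u_0, u_2) + W(u_1, u_3) = 0 says
   exactly that T = P Q^-1.  A loop with matrix gamma = (A B; C D) replaces (P, Q)
   by (A P + B Q, C P + D Q) = ((A T + B) Q, (C T + D) Q), which gives both the
   Moebius action on T and the factor det(C T + D) of w_01; the relation is
   preserved since gamma is symplectic.  Near the base point z(T(z)) = z, whose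
   continuation is itself.  Everything else is uniqueness of analytic
   continuation: zeros of power series are isolated, so "the two germs agree" is
   a locally constant property along a path. *)

(** * Complex power series: isolated zeros and Cauchy products *)

Section PowerSeries.
Variable R : realType.
Local Notation C := (Cx R).
Implicit Types (a c : nat -> C) (x y z l q r rho : C).

Definition psum a y : nat -> C := series (fun n => a n * y ^+ n).

(** Comparability with [0] forces the complex numbers [q] and [e] to be real, so the real statement
    transfers through real parts. *)
Lemma cvg_expr_complex q : 0 <= q -> q < 1 -> (fun n => q ^+ n) @ \oo --> (0 : C).
Proof.
move=> q0 q1; apply/cvgr0Pnorm_lt => e e0.
have qE : q = (complex.Re q)%:C by rewrite RRe_real // ger0_real.
have eE : e = (complex.Re e)%:C by rewrite RRe_real // gtr0_real.
have q0' : 0 <= complex.Re q by rewrite -lecR -qE.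
have q1' : complex.Re q < 1 by rewrite -ltcR -qE.
have e0' : 0 < complex.Re e by rewrite -ltcR -eE.
have /cvgr0Pnorm_lt/(_ _ e0') : (fun n => complex.Re q ^+ n) @ \oo --> (0 : R).
  by apply: cvg_expr; rewrite ger0_norm.
apply: filterS => n; rewrite !ger0_norm ?exprn_ge0 // => h.
by rewrite qE eE -rmorphXn /= ltcR.
Qed.

Lemma geometric_sum_le q n : 0 <= q -> q < 1 -> \sum_(0 <= k < n) q ^+ k <= (1 - q)^-1.
Proof.
move=> q0 q1; have d0 : 0 < 1 - q by rewrite subr_gt0.
rewrite -[leLHS](mulfK (lt0r_neq0 d0)) ler_pdivrMr // mulVf ?lt0r_neq0 //.
rewrite big_mkord mulrC -[1 - q]opprB mulNr -subrX1 opprB.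
by rewrite gerBl exprn_ge0.
Qed.

Lemma norm_cvg_le (s : nat -> C) l M :
  s @ \oo --> l -> (forall n, `|s n| <= M) -> `|l| <= M.
Proof.
move=> sl sM; have M0 : 0 <= M by apply: le_trans (sM 0%N).
rewrite real_leNgt ?ger0_real //; apply/negP => Ml.
have d0 : 0 < `|l| - M by rewrite subr_gt0.
have /cvgrPdist_lt/(_ _ d0) [n _ /(_ n (leqnn n)) /= ln] := sl.
have : `|l| < `|l| - M + M.
  rewrite -{1}(subrK (s n) l) (le_lt_trans (ler_normD _ _)) //.
  by rewrite ltr_leD.
by rewrite subrK ltxx.
Qed.

Lemma pseries_coef_bound a rho l : 0 <= rho -> psum a rho @ \oo --> l ->
  exists2 M, 0 < M & forall n, `|a n| * rho ^+ n <= M.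
Proof.
move=> rho0 al.
have /cvg_seq_bounded/pinfty_ex_gt0 [M M0 HM] :
    cvgn (fun n => a n * rho ^+ n : C).
  by apply/cvg_ex; exists 0; apply: cvg_series_cvg_0; apply/cvg_ex; exists l.
exists M => // n; have := HM n I => /=.
by rewrite normrM normrX (ger0_norm rho0).
Qed.

(* The quotients [(l - a 0) / y] are sums of the shifted series, hence bounded
   by a geometric series of ratio 1/2. *)
Lemma pseries_dist_le a rho l0 : 0 < rho -> psum a rho @ \oo --> l0 ->
  exists2 K, 0 < K & forall y l, `|y| <= rho / 2 ->
    psum a y @ \oo --> l -> `|l - a 0%N| <= K * `|y|.
Proof.
move=> rho0 /(pseries_coef_bound (ltW rho0)) [M M0 aM].
(* Since [|a k.+1| * rho ^+ k.+1 <= M] and [|y| <= rho / 2], the product [|a k.+1| * |y| ^+ k] is at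
   most [M / rho * 2^-1 ^+ k]; the factor [2] is the sum of the geometric series. *)
exists (M / rho * 2); first by rewrite !mulr_gt0 ?invr_gt0.
move=> y l ly al.
have sl : (fun n => psum a y n.+1 - a 0%N) @ \oo --> l - a 0%N.
  apply: cvgB; last exact: cvg_cst.
  by have := al; rewrite -(cvg_shiftS (psum a y)).
apply: norm_cvg_le sl _ => n.
rewrite /psum /series /= big_nat_recl //= expr0 mulr1 addrAC subrr add0r.
rewrite (le_trans (ler_norm_sum _ _ _)) //.
have h1 : (2^-1 : C) < 1 by rewrite invf_lt1 // ltr1n.
have hle := geometric_sum_le n (_ : 0 <= (2^-1 : C)) h1.
rewrite invr_ge0 ler0n in hle; have {}hle := hle isT.
have e2 : (1 - 2^-1 : C)^-1 = 2 by field.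
rewrite e2 in hle.
apply: (@le_trans _ _ (\sum_(0 <= k < n) M / rho * `|y| * 2^-1 ^+ k)); last first.
  rewrite -mulr_sumr [leRHS]mulrAC ler_wpM2l //.
  by rewrite !mulr_ge0 ?invr_ge0 // ltW.
apply: ler_sum => k _; rewrite normrM normrX exprS.
rewrite [leRHS]mulrAC [leRHS]mulrC mulrCA ler_wpM2l //.
rewrite -(ler_pM2r (exprn_gt0 k.+1 rho0)).
apply: le_trans (_ : M * (rho / 2) ^+ k <= _).
  rewrite mulrAC ler_pM ?aM ?lerXn2r ?nnegrE ?mulr_ge0 ?exprn_ge0 ?normr_ge0 //; exact: ltW.
rewrite exprMn exprS le_eqVlt; apply/orP; left; apply/eqP; field.
by rewrite lt0r_neq0.
Qed.

(** This divides out a zero of order at least [k] at the origin. *)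
Lemma psum_shift a k y l : y != 0 -> (forall i, (i < k)%N -> a i = 0) ->
  psum a y @ \oo --> l ->
  psum (fun n => a (k + n)%N) y @ \oo --> l / y ^+ k.
Proof.
move=> y0 ak al.
rewrite (_ : psum _ y = (fun n => psum a y (n + k)%N * (y ^+ k)^-1)).
  by apply: cvgM; [rewrite (cvg_shiftn k (psum a y)) | exact: cvg_cst].
apply/funext => n; rewrite /psum /series /= [in RHS](@big_cat_nat _ _ _ k) ?leq_addl //=.
rewrite [X in (X + _) * _](_ : _ = 0) ?add0r; last first.
  by rewrite big_nat_cond big1 // => i; rewrite andbT => /ak ->; rewrite mul0r.
rewrite -{2}[k]add0n big_addn addnK mulr_suml; apply: eq_bigr => i _.
by rewrite exprD -!mulrA divff ?expf_neq0 // mulr1 addnC.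
Qed.

(** Let [k] be the least index of a nonzero coefficient. Divided by [y ^+ k], the sum stays within
    [K * |y|] of [a k] for small [y], so it cannot vanish once [|y| < |a k| / K]. *)
Lemma pseries_isolated_zero a rho l0 : 0 < rho -> psum a rho @ \oo --> l0 ->
  (exists n, a n != 0) ->
  \forall y \near (0 : C), y != 0 -> forall l, psum a y @ \oo --> l -> l != 0.
Proof.
move=> rho0 al ex; case: (ex_minnP ex) => k ak0 kmin.
have ak i : (i < k)%N -> a i = 0.
  by move=> ik; apply/eqP; apply: contraTT ik => /kmin; rewrite -leqNgt.
have [K K0 HK] := pseries_dist_le rho0 (psum_shift (lt0r_neq0 rho0) ak al).
have c0 : 0 < `|a k| / K by rewrite divr_gt0 // normr_gt0.
have r0 : 0 < rho / 2 by rewrite divr_gt0.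
near=> y => y0 l /(psum_shift y0 ak) /HK; apply: contraPneq => -> /(_ _).
rewrite mul0r sub0r normrN addn0.
have yr : `|y| <= rho / 2 by near: y; exact: (@nbhs0_le C C _ r0).
have yc : `|y| < `|a k| / K by near: y; exact: (@nbhs0_lt C C _ c0).
move=> /(_ yr) h; move: yc; rewrite ltr_pdivlMr // mulrC => /(le_lt_trans h).
by rewrite ltxx.
Unshelve. all: by end_near. Qed.

Definition cauchy_product a c (n : nat) : C := \sum_(0 <= i < n.+1) a i * c (n - i)%N.

(** The product of partial sums runs over a square of index pairs, the Cauchy product over the
    triangle [i + j < n]; the pairs with [i + j >= n] remain. *)
Lemma psum_cauchy_product a c y n :
  psum a y n * psum c y n - psum (cauchy_product a c) y n =
  \sum_(0 <= i < n) \sum_((n - i)%N <= j < n) (a i * c j) * y ^+ (i + j).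
Proof.
have -> : psum (cauchy_product a c) y n =
    \sum_(0 <= i < n) \sum_(0 <= j < n - i) (a i * c j) * y ^+ (i + j).
  rewrite /psum /series /=; elim: n => [|n IHn]; first by rewrite !big_nil.
  rewrite big_nat_recr //= IHn [RHS]big_nat_recr //= /cauchy_product.
  rewrite [in LHS]big_nat_recr //= subnn mulrDl addrA; congr (_ + _); last first.
    by rewrite subSnn big_nat1 addn0.
  rewrite mulr_suml -big_split /=; apply: eq_big_nat => i /andP[_ ltin].
  by rewrite subSn 1?ltnW // big_nat_recr //= subnKC // ltnW.
rewrite /psum /series /= mulr_suml -sumrB; apply: eq_big_nat => i /andP[_ ltin].
rewrite mulr_sumr (@big_cat_nat _ _ _ (n - i)%N 0%N n) ?leq_subr //=.
rewrite (eq_bigr (fun j => a i * c j * y ^+ (i + j))); last first.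
  by move=> j _; rewrite exprD mulrACA.
rewrite addrAC subrr add0r; apply: eq_bigr => j _; by rewrite exprD mulrACA.
Qed.

(** Write [|y| = rho * (th * s)] with [th] and [s] below [1]. A leftover term, having [i + j >= n],
    is at most [M * N * th ^+ n * (s ^+ i * s ^+ j)]: the powers of [s] have bounded sums, and
    [th ^+ n] drives the difference to [0]. *)
Lemma cvg_cauchy_product a c rho (la lc : C) y l (m : C) :
  psum a rho @ \oo --> la -> psum c rho @ \oo --> lc -> `|y| < rho ->
  psum a y @ \oo --> l -> psum c y @ \oo --> m ->
  psum (cauchy_product a c) y @ \oo --> l * m.
Proof.
move=> ar cr yr al cm.
have rho0 : 0 < rho by apply: le_lt_trans yr.
have [M M0 aM] := pseries_coef_bound (ltW rho0) ar.
have [N N0 cN] := pseries_coef_bound (ltW rho0) cr.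
have [s [s0 s1 ys]] : exists s : C, [/\ 0 < s, s < 1 & `|y| / rho < s].
  have q1 : `|y| / rho < 1 by rewrite ltr_pdivrMr // mul1r.
  have q0 : 0 <= `|y| / rho by rewrite divr_ge0 // ltW.
  (* The midpoint of [|y| / rho] and [1] keeps both [s] and the quotient [th] below [1]. *)
  exists ((`|y| / rho + 1) / 2); split.
  - by rewrite divr_gt0 // ltr_wpDl.
  - by rewrite ltr_pdivrMr // mul1r mulr2n ltrD2r.
  - by rewrite ltr_pdivlMr // mulr_natr mulr2n ltrD2l.
pose th := `|y| / rho / s.
have th0 : 0 <= th by rewrite !divr_ge0 // ltW.
have th1 : th < 1 by rewrite ltr_pdivrMr // mul1r.
have D0 : (fun n => psum a y n * psum c y n - psum (cauchy_product a c) y n) @ \oo --> (0 : C).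
  apply/cvgr0Pnorm_lt => e e0.
  have K0 : 0 < M * N * ((1 - s)^-1 * (1 - s)^-1).
    by rewrite !mulr_gt0 // invr_gt0 subr_gt0.
  have /cvgr0Pnorm_lt/(_ _ (divr_gt0 e0 K0)) := cvg_expr_complex th0 th1.
  apply: filterS => n; rewrite ger0_norm ?exprn_ge0 // ltr_pdivlMr // => hn.
  apply: le_lt_trans hn; rewrite psum_cauchy_product.
  apply: (@le_trans _ _ (\sum_(0 <= i < n) \sum_(0 <= j < n)
      th ^+ n * (M * N) * (s ^+ i * s ^+ j))); last first.
    under eq_bigr do rewrite -mulr_sumr -mulr_sumr.
    rewrite -mulr_sumr -mulr_suml -!mulrA !ler_wpM2l ?exprn_ge0 //; try exact: ltW.
    have S0 : 0 <= \sum_(0 <= k < n) s ^+ k by apply: sumr_ge0 => k _; rewrite exprn_ge0 // ltW.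
    by apply: ler_pM => //; apply: geometric_sum_le => //; exact: ltW.
  rewrite (le_trans (ler_norm_sum _ _ _)) // ler_sum_nat // => i /andP[_ ltin].
  rewrite (le_trans (ler_norm_sum _ _ _)) //.
  rewrite [leRHS](@big_cat_nat _ _ _ (n - i)%N) ?leq_subr //= ler_wpDl //.
    apply: sumr_ge0 => j _; rewrite !mulr_ge0 ?exprn_ge0 //; exact: ltW.
  rewrite ler_sum_nat // => j /andP[lij _].
  rewrite !normrM normrX.
  have yE : `|y| = rho * (th * s) by rewrite /th; field; rewrite !lt0r_neq0.
  have -> : `|a i| * `|c j| * `|y| ^+ (i + j) =
      (`|a i| * rho ^+ i) * (`|c j| * rho ^+ j) * th ^+ (i + j) * (s ^+ i * s ^+ j).
    by rewrite yE !exprMn !exprD; ring.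
  rewrite [_ ^+ n * _]mulrC ler_wpM2r //.
    by rewrite mulr_ge0 // exprn_ge0 // ltW.
  have rX k : 0 <= rho ^+ k by rewrite exprn_ge0 // ltW.
  apply: ler_pM; rewrite ?mulr_ge0 //; first exact: exprn_ge0.
    by apply: ler_pM; rewrite ?mulr_ge0.
  by rewrite ler_wiXn2l //; [exact: ltW|rewrite -leq_subLR].
rewrite -[l * m]subr0.
rewrite (_ : psum _ y = (fun n => psum a y n * psum c y n -
    (psum a y n * psum c y n - psum (cauchy_product a c) y n))).
  exact: cvgB (cvgM al cm) D0.
by apply/funext => n; rewrite subKr.
Qed.
End PowerSeries.

(** * Analytic germs and uniqueness of their continuation *)

Section Analytic.
Variable R : realType.
Local Notation C := (Cx R).
Implicit Types (f g : C -> C) (x y z : C).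

Lemma has_pseriesP f z : has_pseries f z <->
  exists a, \forall y \near (0 : C), psum a y @ \oo --> f (z + y).
Proof.
split=> [[a [r r0 H]]|[a /nbhs_normP[r /= r0 H]]]; exists a.
  near=> y; have := H (z + y); rewrite addrAC subrr add0r; apply.
  by near: y; exact: (@nbhs0_lt C C _ r0).
exists r => // x xr; have := H (x - z); rewrite /= sub0r normrN subrKC; exact.
Unshelve. all: by end_near. Qed.

Lemma has_pseriesB f g z : has_pseries f z -> has_pseries g z ->
  has_pseries (fun x => f x - g x) z.
Proof.
move=> /has_pseriesP[a af] /has_pseriesP[c cg]; apply/has_pseriesP.
exists (fun n => a n - c n); apply: filterS (filterI af cg) => y [ay cy].
rewrite (_ : psum _ y = (fun n => psum a y n - psum c y n)); last first.
  by apply/funext => n; rewrite /psum /series /= -sumrB; apply: eq_bigr => i _; rewrite mulrBl.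
exact: cvgB ay cy.
Qed.

Lemma has_pseries_cst (k z : C) : has_pseries (fun=> k) z.
Proof.
apply/has_pseriesP; exists (fun n => if n is 0%N then k else 0); near=> y.
rewrite -(cvg_shiftS (psum _ y)) (_ : (fun n => _) = cst k); first exact: cvg_cst.
apply/funext => n; rewrite /psum /series /= big_nat_recl //= mulr1 big1 ?addr0 // => i _.
by rewrite mul0r.
Unshelve. all: by end_near. Qed.

Lemma has_pseries_id z : has_pseries id z.
Proof.
apply/has_pseriesP; exists (fun n => if n is m.+1 then (if m is 0%N then 1 else 0) else z).
near=> y; rewrite -(cvg_shiftn 2 (psum _ y)) (_ : (fun n => _) = cst (z + y)); first exact: cvg_cst.
apply/funext => n; rewrite /psum /series /= addn2 !big_nat_recl //= mulr1 mul1r expr1.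
by rewrite big1 ?addr0 // => i _; rewrite mul0r.
Unshelve. all: by end_near. Qed.

Lemma has_pseriesM f g z : has_pseries f z -> has_pseries g z ->
  has_pseries (fun x => f x * g x) z.
Proof.
move=> /has_pseriesP[a af] /has_pseriesP[c cg]; apply/has_pseriesP.
exists (cauchy_product a c).
have [r /= r0 H] := (nbhs_normP _ _).1 (filterI af cg).
(* The point [r / 2] lies inside the disc where both series converge; it is the comparison radius
   [rho] of [cvg_cauchy_product]. *)
have r20 : 0 < r / 2 by rewrite divr_gt0.
have [|ar cr] := H (r / 2).
  by rewrite /= sub0r normrN gtr0_norm // ltr_pdivrMr // ltr_pMr // ltr1n.
apply: filterS (filterI (filterI af cg) (@nbhs0_lt C C _ r20)) => y [[ay cy] yr].
exact: cvg_cauchy_product ar cr yr ay cy.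
Qed.

(** [pseries_dist_le] is a Lipschitz bound at the centre; taken at [y = 0] it also identifies [a 0]
    with [f z]. *)
Lemma has_pseries_continuous f z : has_pseries f z -> f @ z --> f z.
Proof.
move=> /has_pseriesP[a /nbhs_normP[r /= r0 H]].
have r20 : 0 < r / 2 by rewrite divr_gt0.
have /pseries_dist_le-/(_ r20)[K K0 HK] : psum a (r / 2) @ \oo --> f (z + r / 2).
  by apply: H; rewrite /= sub0r normrN gtr0_norm // ltr_pdivrMr // ltr_pMr // ltr1n.
have fz : f z = a 0%N.
  have := HK 0 (f z); rewrite normr0 mulr0 normr_le0 subr_eq0 => h; apply/eqP/h.
    by rewrite divr_ge0 // ltW.
  by have := H 0; rewrite /= subrr normr0 addr0; apply.
apply/(@cvgrPdistC_lt C C C (nbhs z)) => e e0; rewrite fz.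
near=> x.
have xz : `|x - z| < r / 2 / 2.
  by near: x; apply/nbhs_normP; exists (r / 2 / 2); rewrite /= ?divr_gt0 // => x /=; rewrite distrC.
have xe : `|x - z| < e / K.
  by near: x; apply/nbhs_normP; exists (e / K); rewrite /= ?divr_gt0 // => x /=; rewrite distrC.
apply: le_lt_trans (HK (x - z) (f x) (ltW xz) _) _.
  have := H (x - z); rewrite subrKC; apply; rewrite /= sub0r normrN.
  by rewrite (lt_trans xz) // -mulrA gtr_pMr // -invfM invf_lt1 -?natrM ?ltr1n ?ltr0n.
by rewrite mulrC -ltr_pdivlMr.
Unshelve. all: by end_near. Qed.

Lemma has_pseries_zero_or_isolated f z : has_pseries f z ->
  (\forall x \near z, f x = 0) \/ (\forall x \near z, x != z -> f x != 0).
Proof.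
move=> /has_pseriesP[a H].
have nz (P : C -> Prop) : (\forall y \near (0 : C), P y) -> \forall x \near z, P (x - z).
  move=> /nbhs_normP[r r0 Hr]; apply/nbhs_normP; exists r => // x /= xr; apply: Hr.
  by rewrite /= sub0r normrN distrC.
have [a0|/existsNP ex] := pselect (forall n, a n = 0).
  left; apply: filterS (nz _ H) => x; rewrite subrKC => ax.
  apply: cvg_unique ax _; first exact: norm_hausdorff.
  rewrite (_ : psum _ _ = cst 0); first exact: cvg_cst.
  by apply/funext => n; rewrite /psum /series /= big1 // => i _; rewrite a0 mul0r.
right; have [r /= r0 Hr] := (nbhs_normP _ _).1 H.
have r20 : 0 < r / 2 by rewrite divr_gt0.
have ar : psum a (r / 2) @ \oo --> f (z + r / 2).
  by apply: Hr; rewrite /= sub0r normrN gtr0_norm // ltr_pdivrMr // ltr_pMr // ltr1n.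
have {}ex : exists n, a n != 0 by case: ex => n /eqP; exists n.
apply: filterS (nz _ (filterI H (pseries_isolated_zero r20 ar ex))) => x [ax h] xz.
have xz0 : x - z != 0 by rewrite subr_eq0.
by rewrite -(subrKC z x); exact: h xz0 _ ax.
Qed.

Lemma nearby_distinct (P : C -> Prop) z : (\forall x \near z, P x) -> exists2 x, x != z & P x.
Proof.
move=> /nbhs_normP[e /= e0 He]; have e20 : 0 < e / 2 by rewrite divr_gt0.
exists (z + e / 2); first by rewrite -subr_eq0 addrAC subrr add0r lt0r_neq0.
apply: He; rewrite /= opprD addNKr normrN gtr0_norm //.
by rewrite ltr_pdivrMr // ltr_pMr // ltr1n.
Qed.

(** This is the local constancy behind the identity theorem: if the germ at [z] is nonzero, its
    zeros are isolated, so no nearby [y != z] carries the zero germ. *)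
Lemma has_pseries_germ_eq0 f z : has_pseries f z ->
  \forall y \near z, (\forall x \near y, f x = 0) <-> (\forall x \near z, f x = 0).
Proof.
case/has_pseries_zero_or_isolated => [f0|fN].
  by have := near_join f0; apply: filterS => y fy; split.
have nf0 : ~ \forall x \near z, f x = 0.
  by move=> f0; have [x xz [fx /(_ xz)]] := nearby_distinct (filterI f0 fN); rewrite fx eqxx.
apply: filterS fN => y fy; split => [fy0|/nf0 []].
have [yz|/fy] := eqVneq y z; first by rewrite -yz.
have fy00 : f y = 0 by exact: (nbhs_singleton fy0).
by move=> /eqP /(_ fy00) [].
Qed.

(** By connectedness of the interval: the points where [P] holds form a relatively open and
    relatively closed subset. *)
Lemma locally_constant_01 (P : R -> Prop) :
  (forall t : R, t \in `[0, 1] -> \forall s \near t, s \in `[0, 1] -> (P s <-> P t)) ->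
  P 0 -> P 1.
Proof.
move=> lcP P0; pose I01 : set R := `[0, 1]%classic.
have inI t : I01 t = (t \in `[0, 1]) by [].
suff /seteqP[_ /(_ 1)] : I01 `&` [set t | P t] = I01.
  by case=> //; rewrite inI bound_itvE.
apply: (@segment_connected R 0 1).
- by exists 0; split => //; rewrite inI bound_itvE.
(* The premise [I01 t] imposes nothing outside the interval, so an endpoint where [P] holds is
   interior as well. *)
- exists [set t | I01 t -> P t]°; first exact: open_interior.
  apply/seteqP; split => t [It Pt]; split => //.
    by apply: filterS (lcP t It) => s h Is; apply/h.
  exact: (nbhs_singleton Pt).
- exists (~` [set t | I01 t -> ~ P t]°); first exact/open_closedC/open_interior.
  apply/seteqP; split => t [It Pt]; split => //.
    by move=> /nbhs_singleton /= /(_ It).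
  apply: contrapT => nPt; apply: Pt; apply: filterS (lcP t It) => s h Is.
  by move=> /(h Is).1 /nPt.
Qed.

(** The property carried from [0] to [1] is that [F t - G t] vanishes near [p t]. *)
Lemma continuation_unique (p : R -> C) f f' g g' :
  {within `[0, 1], continuous p} -> germ_eq (p 0) f f' ->
  continuation p f g -> continuation p f' g' -> germ_eq (p 1) g g'.
Proof.
move=> /subspace_continuousP cp ff' [F [aF cF F0 F1]] [G [aG cG G0 G1]].
suff : \forall x \near p 1, F 1 x - G 1 x = 0.
  move=> FG; apply: filterS (filterI FG (filterI F1 G1)) => x [/eqP].
  by rewrite subr_eq0 => /eqP e [<- <-].
apply: (@locally_constant_01 (fun t => \forall x \near p t, F t x - G t x = 0)); last first.
  apply: filterS (filterI ff' (filterI F0 G0)) => x [e [<- <-]].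
  by rewrite e subrr.
move=> t t01.
have ana : has_pseries (fun x => F t x - G t x) (p t).
  by apply: has_pseriesB; apply: nbhs_singleton; [exact: aF|exact: aG].
(* Continuity of [p] pulls a statement about points near [p t] back to parameters near [t]. The
   elements [F t] and [G t] are still fixed here; compatibility of neighbouring elements then
   exchanges them for [F s] and [G s]. *)
have cpt : \forall s \near t, s \in `[0, 1] ->
    ((\forall x \near p s, F t x - G t x = 0) <-> (\forall x \near p t, F t x - G t x = 0)).
  exact: (cp t t01 _ (has_pseries_germ_eq0 ana)).
apply: filterS (filterI cpt (filterI (cF t t01) (cG t t01))).
move=> s [/= h [Fs Gs]] s01; apply: iff_trans (h s01).
by split=> H; apply: filterS (filterI H (filterI (Fs s01) (Gs s01))) => x;
  move=> [e [eF eG]]; move: e; rewrite eF eG.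
Qed.

End Analytic.

(** * Pointwise linear algebra of the period matrix *)

Section PeriodMatrix.
Variable F : fieldType.
Implicit Types (a b : 'cV[F]_2) (v w : 'cV[F]_(2 + 2)) (k : F).

Definition pair_mx a b : 'M[F]_2 := \matrix_(i, j) if j == 0 then a i 0 else b i 0.

Lemma mul_pair_mx (A B : 'M[F]_2) a b c d :
  A *m pair_mx a b + B *m pair_mx c d = pair_mx (A *m a + B *m c) (A *m b + B *m d).
Proof.
apply/matrixP => i j; rewrite !mxE.
by case: eqVneq => [->|/negPf j0]; congr (_ + _); apply: eq_bigr => l _;
  rewrite !mxE ?eqxx ?j0.
Qed.

(** With [v] and [w] the columns of the [u_j] and of their derivatives, this is the value of [w_jm]
    at a point; [rev_ord] is needed because [colvec] lists [u_3] first. *)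
Definition wedge k v w (j m : 'I_4) : F :=
  k * (v (rev_ord j) 0 * w (rev_ord m) 0 - w (rev_ord j) 0 * v (rev_ord m) 0).

Definition wedge_period (W : 'I_4 -> 'I_4 -> F) : 'M[F]_2 :=
  \matrix_(i, j) [:: W 0 3 / W 0 1; W 0 2 / W 0 1; - W 1 2 / W 0 1]`_(i + j)%N.

(** The sign comes from the row order: the lower half lists [u_1] above [u_0]. *)
Lemma wedge01_det k v w :
  wedge k v w 0 1 = - k * \det (pair_mx (dsubmx v) (dsubmx w)).
Proof.
rewrite (expand_det_row _ 0) !big_ord_recl big_ord0 /cofactor !det_mx11 !mxE /= /wedge.
rewrite addr0 !expr1 !expr0.
rewrite (_ : rev_ord (0 : 'I_4) = rshift 2 1); last exact/val_inj.
rewrite (_ : rev_ord (1 : 'I_4) = rshift 2 0); last exact/val_inj.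
rewrite (_ : lift 0 0 = 1); last exact/val_inj.
ring.
Qed.

(** The second row is the three-term identity [w_02 u_1 - w_12 u_0 = w_01 u_2]. The first row
    becomes [w_03 u_1 - w_13 u_0 = w_01 u_3] once the relation replaces [w_02] by [- w_13]. *)
Lemma mul_wedge_period k v w : wedge k v w 0 1 != 0 ->
  wedge k v w 0 2 + wedge k v w 1 3 = 0 ->
  wedge_period (wedge k v w) *m pair_mx (dsubmx v) (dsubmx w) =
  pair_mx (usubmx v) (usubmx w).
Proof.
move=> w01 w02.
have r0 : rev_ord (0 : 'I_4) = rshift 2 1 by exact/val_inj.
have r1 : rev_ord (1 : 'I_4) = rshift 2 0 by exact/val_inj.
have r2 : rev_ord (2 : 'I_4) = @lshift 2 2 1 by exact/val_inj.
have r3 : rev_ord (3 : 'I_4) = @lshift 2 2 0 by exact/val_inj.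
have k0 : k != 0 by apply: contraNneq w01 => ->; rewrite /wedge mul0r.
have {}w02 : v (rshift 2 1) 0 * w (@lshift 2 2 1) 0 - w (rshift 2 1) 0 * v (@lshift 2 2 1) 0 =
    v (@lshift 2 2 0) 0 * w (rshift 2 0) 0 - w (@lshift 2 2 0) 0 * v (rshift 2 0) 0.
  apply: (mulfI k0); apply/eqP; rewrite -subr_eq0; move: w02.
  by rewrite /wedge r0 r1 r2 r3 => <-; apply/eqP; ring.
have o0 : ord0 = 0 :> 'I_2 by exact/val_inj.
have l0 : lift 0 0 = 1 :> 'I_2 by exact/val_inj.
rewrite /wedge r0 r1 mulf_eq0 negb_or k0 /= in w01.
have ord2 (i : 'I_2) : i = 0 \/ i = 1.
  by case: i => [[|[|//]] ?]; [left|right]; exact/val_inj.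
apply/matrixP => i j; rewrite !mxE !big_ord_recl big_ord0 !mxE l0 o0 addr0 /=.
rewrite /wedge r0 r1 r2 r3.
have [->|->] := ord2 i; last first.
  by have [->|->] := ord2 j; rewrite /=; field; rewrite w01.
by rewrite /= w02; have [->|->] := ord2 j; rewrite /=; field; rewrite w01.
Qed.

Definition symp4 : 'M[F]_(2 + 2) := block_mx 0 1%:M (- 1%:M) 0.

(** This reads the Wronskian relation as the vanishing of the symplectic pairing of [v] and [w], a
    condition visibly preserved by symplectic matrices. *)
Lemma wedge_symp k v w :
  wedge k v w 0 2 + wedge k v w 1 3 = - k * (v^T *m symp4 *m w) 0 0.
Proof.
have r0 : rev_ord (0 : 'I_4) = rshift 2 1 by exact/val_inj.
have r1 : rev_ord (1 : 'I_4) = rshift 2 0 by exact/val_inj.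
have r2 : rev_ord (2 : 'I_4) = @lshift 2 2 1 by exact/val_inj.
have r3 : rev_ord (3 : 'I_4) = @lshift 2 2 0 by exact/val_inj.
have o0 : ord0 = 0 :> 'I_2 by exact/val_inj.
have l0 : lift 0 0 = 1 :> 'I_2 by exact/val_inj.
rewrite -[v in RHS]vsubmxK -[w in RHS]vsubmxK tr_col_mx mul_row_block mul_row_col.
rewrite !mulmx0 add0r addr0 mulmxN !mulmx1 mulNmx !mxE !big_ord_recl !big_ord0 !mxE l0 o0.
by rewrite /wedge r0 r1 r2 r3; ring.
Qed.

(** Since [W 0 1] is nonzero, the determinant formula makes [W' 0 1] nonzero exactly when [S] is
    invertible, so the Moebius image is only claimed there. *)
Lemma wedge_period_moebius k v w (g : 'M[F]_(2 + 2)) :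
  wedge k v w 0 1 != 0 -> wedge k v w 0 2 + wedge k v w 1 3 = 0 ->
  g^T *m symp4 *m g = symp4 ->
  let W := wedge k v w in let W' := wedge k (g *m v) (g *m w) in
  let S := dlsubmx g *m wedge_period W + drsubmx g in
  W' 0 1 = \det S * W 0 1 /\
  (W' 0 1 != 0 -> S \in unitmx /\
   wedge_period W' = (ulsubmx g *m wedge_period W + ursubmx g) *m invmx S).
Proof.
move=> w01 w02 gS W W' S; set T := wedge_period W in S *.
have k0 : k != 0 by apply: contraNneq w01 => ->; rewrite /wedge mul0r.
set P := pair_mx (usubmx v) (usubmx w); set Q := pair_mx (dsubmx v) (dsubmx w).
have TQ : T *m Q = P by exact: mul_wedge_period.
have Qu : Q \in unitmx.
  rewrite unitmxE unitfE; apply: contraNneq w01; rewrite wedge01_det => ->.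
  by rewrite mulr0.
have gE (x : 'cV[F]_(2 + 2)) : g *m x = col_mx (ulsubmx g *m usubmx x + ursubmx g *m dsubmx x)
     (dlsubmx g *m usubmx x + drsubmx g *m dsubmx x).
  by rewrite -{1}[g]submxK -{1}[x]vsubmxK mul_block_col.
have QE : pair_mx (dsubmx (g *m v)) (dsubmx (g *m w)) = S *m Q.
  by rewrite !gE !col_mxKd -mul_pair_mx -/P -/Q -TQ mulmxDl mulmxA.
have PE : pair_mx (usubmx (g *m v)) (usubmx (g *m w)) = (ulsubmx g *m T + ursubmx g) *m Q.
  by rewrite !gE !col_mxKu -mul_pair_mx -/P -/Q -TQ mulmxDl mulmxA.
have W'01 : W' 0 1 = \det S * W 0 1.
  by rewrite /W' /W !wedge01_det QE det_mulmx mulrCA.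
split=> // w'01; have Su : S \in unitmx.
  by rewrite unitmxE unitfE; apply: contraNneq w'01; rewrite W'01 => ->; rewrite mul0r.
split=> //.
(* The relation must hold for the transformed columns too before [mul_wedge_period] can be applied
   to them. *)
have w'02 : W' 0 2 + W' 1 3 = 0.
  rewrite /W' wedge_symp trmx_mul -!mulmxA (mulmxA symp4) (mulmxA g^T) (mulmxA g^T) gS.
  by rewrite mulmxA -wedge_symp.
have := mul_wedge_period w'01 w'02; rewrite QE PE mulmxA => /(canRL (mulmxK Qu)).
by rewrite mulmxK // => <-; rewrite mulmxK.
Qed.
End PeriodMatrix.

(** * Operations on analytic continuations *)

Section Continuation.
Variable R : realType.
Local Notation C := (Cx R).
Implicit Types (p : R -> C) (f g h : C -> C).

Lemma germ_eq_trans (z : C) f g h : germ_eq z f g -> germ_eq z g h -> germ_eq z f h.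
Proof. by move=> fg gh; apply: filterS (filterI fg gh) => x [-> ->]. Qed.

Lemma eq_continuation p f g f' g' : germ_eq (p 0) f f' -> germ_eq (p 1) g g' ->
  continuation p f g -> continuation p f' g'.
Proof.
move=> ff' gg' [F [aF cF F0 F1]]; exists F; split; [exact: aF | exact: cF | | exact: germ_eq_trans F1 gg'].
by apply: filterS (filterI ff' F0) => x [<- <-].
Qed.

(** An abstract [op] lets one argument serve products and differences, from which every [wedge] is
    built. *)
Lemma continuation_op2 (op : C -> C -> C) :
  (forall f g z, has_pseries f z -> has_pseries g z ->
     has_pseries (fun x => op (f x) (g x)) z) ->
  forall p f f' g g', continuation p f f' -> continuation p g g' ->
    continuation p (fun x => op (f x) (g x)) (fun x => op (f' x) (g' x)).
Proof.
move=> anop p f f' g g' [F [aF cF F0 F1]] [G [aG cG G0 G1]].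
exists (fun t x => op (F t x) (G t x)); split.
- by move=> t t01; apply: filterS (filterI (aF t t01) (aG t t01)) => x [fx gx]; exact: anop.
- move=> t t01; apply: filterS (filterI (cF t t01) (cG t t01)) => s [Fs Gs] s01.
  by apply: filterS (filterI (Fs s01) (Gs s01)) => x [-> ->].
- by apply: filterS (filterI F0 G0) => x [-> ->].
- by apply: filterS (filterI F1 G1) => x [-> ->].
Qed.

Lemma continuation_analytic p f : (forall z, has_pseries f z) -> continuation p f f.
Proof.
move=> an; have ge z : germ_eq z f f by near=> x.
exists (fun=> f); split; [| |exact: ge|exact: ge] => t _.
  by near=> x; exact: an.
by near=> s => _; exact: ge.
Unshelve. all: by end_near. Qed.

Lemma continuation_wedge p (k : C) (u v M N : C -> 'cV[C]_(2 + 2)) :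
  (forall i, continuation p (fun x => u x i 0) (fun x => M x i 0)) ->
  (forall i, continuation p (fun x => v x i 0) (fun x => N x i 0)) ->
  forall j m, continuation p (fun x => wedge k (u x) (v x) j m)
                             (fun x => wedge k (M x) (N x) j m).
Proof.
move=> uM vN j m; have cM := continuation_op2 (@has_pseriesM R).
apply: (cM p); first by apply: continuation_analytic => z; exact: has_pseries_cst.
apply: (continuation_op2 (op := fun x y => x - y) (@has_pseriesB R)); exact: (cM p).
Qed.

(** Near [p 0] the function [f] agrees with the first element of the continuation, whose power
    series makes it continuous there. *)
Lemma continuation_neq0 p f g : continuation p f g -> f (p 0) != 0 ->
  \forall x \near p 0, f x != 0.
Proof.
move=> [F [aF _ F0 _]]; have t0 : (0 : R) \in `[0, 1] by rewrite bound_itvE.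
have fF : f (p 0) = F 0 (p 0) by exact: (nbhs_singleton F0).
have := has_pseries_continuous (nbhs_singleton (aF 0 t0)) => cF0; rewrite fF => n0.
have F_neq0 : \forall x \near p 0, F 0 x != 0 by exact: (@cvgr_neq0 C C C (nbhs (p 0)) _ (F 0) _ cF0).
by apply: filterS (filterI F0 F_neq0) => x [->].
Qed.

End Continuation.

(** * The Moebius action of symplectic matrices *)

Section SymplecticAction.
Variable R : realType.
Local Notation C := (Cx R).
Implicit Types (g : 'M[R]_(2 + 2)) (T : 'M[C]_2).

Lemma cmxM g h : cmx (g *m h) = cmx g *m cmx h.
Proof. exact: (map_mxM (real_complex R)). Qed.

Lemma cmx1 : cmx (1%:M : 'M[R]_(2 + 2)) = 1%:M.
Proof. exact: (map_mx1 (real_complex R)). Qed.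

Lemma cmx_symp_form : cmx (symp_form R) = symp4 C.
Proof.
rewrite /cmx /symp_form /symp4 map_block_mx.
congr block_mx; apply/matrixP => i j; rewrite !mxE //.
- by rewrite -[LHS]/((1 *+ (i == j))%:C) rmorphMn.
- by rewrite -[LHS]/((- (1 *+ (i == j)))%:C) rmorphN rmorphMn.
Qed.

Lemma Sp4_cmx g : Sp4 R g -> (cmx g)^T *m symp4 C *m cmx g = symp4 C.
Proof.
move=> gS; rewrite -cmx_symp_form -{2}(gS : _ = _) !cmxM; congr (_ *m _ *m _).
by rewrite /cmx map_trmx.
Qed.

(** With [J] the symplectic form, [J^2 = -1] gives the left inverse [- J g^T J]. *)
Lemma Sp4_unit g : Sp4 R g -> g \in unitmx.
Proof.
move=> gS; have JJ : symp_form R *m symp_form R = - 1%:M.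
  rewrite /symp_form mulmx_block !mul0mx !mulmx0 !mul1mx ?mulmx1 ?addr0 ?add0r.
  by rewrite [in RHS]scalar_mx_block opp_block_mx !oppr0.
have : (- symp_form R *m g^T *m symp_form R) *m g = 1%:M.
  by rewrite -!mulmxA (mulmxA g^T) (gS : _ = _) mulNmx JJ opprK.
by case/mulmx1_unit.
Qed.

(** In homogeneous coordinates the action is linear: [moebius g T] is the upper block times the
    inverse of the lower one. *)
Lemma cmx_mul_col g T : cmx g *m col_mx T 1%:M =
  col_mx (ulsubmx (cmx g) *m T + ursubmx (cmx g)) (automorphy_mx g T).
Proof. by rewrite -{1}[cmx g]submxK mul_block_col !mulmx1. Qed.

(** The inverse of [g] sends the column of [moebius g T] and [1] to that of [T S^-1] and [S^-1],
    whose quotient is [T]. *)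
Lemma moebiusK g T : g \in unitmx -> automorphy_mx g T \in unitmx ->
  moebius (invmx g) (moebius g T) = T.
Proof.
move=> gu Su; set S := automorphy_mx g T in Su *.
have E : col_mx (moebius g T) 1%:M = cmx g *m col_mx T 1%:M *m invmx S.
  by rewrite cmx_mul_col mul_col_mx mulmxV.
have := cmx_mul_col (invmx g) (moebius g T).
rewrite {1}E mulmxA (mulmxA (cmx (invmx g))) -cmxM mulVmx // cmx1 mul1mx mul_col_mx mul1mx.
by move=> /eq_col_mx [E1 E2]; rewrite {1}/moebius -E1 -E2 invmxK mulmxKV.
Qed.

End SymplecticAction.

(** * Monodromy along loops and a criterion for modularity *)

Section Loops.
Variable R : realType.
Local Notation C := (Cx R).
Implicit Types (L : 'I_4 -> ratfun C) (b : C) (u : 'I_4 -> C -> C).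

(* Gamma is only determined up to scalars by the loops, but the monodromy
   matrix is itself symplectic, so the scalar is a sign. *)
Lemma loop_of_sign L b u Gamma g l :
  (forall c : 'I_4 -> C, (\forall x \near b, \sum_i c i * u i x = 0) ->
     forall i, c i = 0) ->
  Gamma `<=` Sp4 R ->
  (forall l : R -> C, loop_avoiding (singular L) b l ->
     exists g, [/\ Gamma g, continues_by l (colvec u) (cmx g)
       & continues_by l (colvec (fun j => derive1 (u j))) (cmx g)]) ->
  Gamma g -> loop_of L b u g l ->
  exists c : C, [/\ c ^+ 2 = 1, continues_by l (colvec u) (c *: cmx g)
     & continues_by l (colvec (fun j => derive1 (u j))) (c *: cmx g)].
Proof.
move=> ufree GS ucont Gg [lav [c c0 cu]]; exists c.
have [g' [Gg' cu' cdu']] := ucont l lav; case: lav => lc l0 l1 _.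
have cg : c *: cmx g = cmx g'.
  apply/eqP; rewrite -subr_eq0; apply/eqP/matrixP => i j; rewrite [RHS]mxE -(rev_ordK j).
  (* Both matrices describe the continuation of the same germs, so each row of their difference is a
     linear relation among the [u_j]. *)
  apply: (ufree (fun j => (c *: cmx g - cmx g') i (rev_ord j))).
  have ge : germ_eq (l 0) (fun x => colvec u x i 0) (fun x => colvec u x i 0) by near=> x.
  have := continuation_unique lc ge (cu i) (cu' i); rewrite l1.
  apply: filterS => x /eqP; rewrite -subr_eq0 => /eqP E.
  rewrite -[RHS]E (reindex_inj rev_ord_inj) !mxE -sumrB; apply: eq_bigr => m _.
  by rewrite rev_ordK !mxE mulrBl.
rewrite cg; split=> //.
(* Comparing the symplectic relations of [c *: cmx g] and [cmx g] gives [c^2 J = J], read off at an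
   entry of [J] equal to [1]. *)
have := Sp4_cmx (GS _ Gg'); rewrite -cg -scalemxAr [(c *: _)^T]linearZ /= -!scalemxAl scalerA.
rewrite (Sp4_cmx (GS _ Gg)) => /matrixP/(_ (lshift 2 0) (rshift 2 0)).
by rewrite /symp4 mxE block_mxEur mxE eqxx mulr1 expr2.
Unshelve. all: by end_near. Qed.

(** Modularity in [T] reduces to a statement in the variable [z]: near [b], [zeta] recovers [z] from
    [T], and uniqueness of continuation makes every branch agree with the computed [h]. *)
Lemma modular_form_of_continuation L b u Gamma (T : C -> 'M[C]_2) (zeta : C -> C)
    (f : 'M[C]_2 -> C) (f0 : C -> C) (k : int) :
  Gamma `<=` Sp4 R ->
  (\forall x \near b, zeta (T x 0 0) = x) -> germ_eq b (fun x => f (T x)) f0 ->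
  (forall g l, Gamma g -> loop_of L b u g l -> exists2 h, continuation l f0 h &
     \forall x \near b, h x = \det (automorphy_mx g (T x)) ^ k * f0 x) ->
  modular_form L b u Gamma T f k.
Proof.
move=> GS zT ff0 H g l Gg gl; have [h fh hE] := H g l Gg gl.
have [[lc l0 l1 _] _] := gl.
have fTh : continuation l (fun x => f (T x)) h.
  apply: eq_continuation fh; first by rewrite l0; apply: filterS ff0 => x ->.
  by near=> x.
split.
  (* To evaluate the branch at [M], undo [g], recover [z] with [zeta] and apply [h]. *)
  exists (fun M => h (zeta (moebius (invmx g) M 0 0))), h => //.
  apply: filterS zT => x zx Su.
  by rewrite moebiusK ?zx //; apply: Sp4_unit; exact: GS.
move=> f' [h' fh' f'h'].
have hh' : germ_eq b h h'.
  rewrite -l1; apply: continuation_unique lc _ fTh fh'; by near=> x.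
apply: filterS (filterI (filterI f'h' hh') (filterI hE ff0)) => x [[e1 e2] [e3 e4]] Su.
by rewrite e1 // -e2 e3 e4.
Unshelve. all: by end_near. Qed.

End Loops.

Theorem theorem1 (R : realType) (L : 'I_4 -> ratfun (Cx R))
    (Gamma : set 'M[R]_(2 + 2)) (b : Cx R) (u : 'I_4 -> Cx R -> Cx R)
    (kappa : Cx R) (zeta : Cx R -> Cx R)
    (L_regular : regular_singularities L)
    (L_mum : has_mum_point L)
    (b_ordinary : ~ singular L b)
    (u_basis : solution_basis L b u)
    (Gamma_subgroup : subgroup_of Gamma (Sp4 R))
    (Gamma_commensurable : exists Delta : set 'M[R]_(2 + 2),
       [/\ subgroup_of Delta (Sp4Z R), discrete_subset Delta
         & commensurable Gamma Delta])
    (Gamma_monodromy : projective_monodromy_group L b u Gamma)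
    (u_wronskian : \forall x \near b,
       wronskian (u 0) (u 2) x + wronskian (u 1) (u 3) x = 0)
    (u_continuation : forall l : R -> Cx R,
       loop_avoiding (singular L) b l ->
       exists g, [/\ Gamma g,
         continues_by l (colvec u) (cmx g)
       & continues_by l (colvec (fun j => derive1 (u j))) (cmx g)])
    (kappa_neq0 : kappa != 0)
    (w01_neq0 : wfun kappa u 0 1 b != 0)
    (zeta_inverse : local_inverse b (tau1 (wfun kappa u)) zeta) :
  [/\ T_continues_by_moebius L b u Gamma (wfun kappa u),
      modular_form L b u Gamma (Tmx (wfun kappa u))
        (fun T => zeta (T 0 0)) 0
    & modular_form L b u Gamma (Tmx (wfun kappa u))
        (fun T => wfun kappa u 0 1 (zeta (T 0 0))) 1].
Proof.
have [_ ufree _] := u_basis; have [GS _ _ _] := Gamma_subgroup.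
have [_ zetaK _] := zeta_inverse.
pose V := colvec u; pose V' := colvec (fun j => derive1 (u j)).
have wE j m : wfun kappa u j m = (fun x => wedge kappa (V x) (V' x) j m).
  by apply/funext => x; rewrite /wedge !mxE !rev_ordK.
have TE x : Tmx (wfun kappa u) x = wedge_period (wedge kappa (V x) (V' x)).
  by apply/matrixP => i j; rewrite !mxE /tau1 /tau2 /tau3 !wE.
have w01_near : \forall x \near b, wfun kappa u 0 1 x != 0.
  (* The constant loop supplies a continuation of [w_01], hence its continuity at [b]. *)
  have lb : loop_avoiding (singular L) b (fun=> b).
    by split=> //; apply: continuous_subspaceT => x; exact: cvg_cst.
  have [g [_ cV cV']] := u_continuation _ lb.
  apply: continuation_neq0 w01_neq0; rewrite wE.
  exact: (continuation_wedge kappa cV cV').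
have key g l : Gamma g -> loop_of L b u g l ->
  [/\ forall j m, continuation l (wfun kappa u j m)
        (fun x => wedge kappa (cmx g *m V x) (cmx g *m V' x) j m),
      \forall x \near b, wedge kappa (cmx g *m V x) (cmx g *m V' x) 0 1 =
        \det (automorphy_mx g (Tmx (wfun kappa u) x)) * wfun kappa u 0 1 x
    & \forall x \near b, wedge kappa (cmx g *m V x) (cmx g *m V' x) 0 1 != 0 ->
        automorphy_mx g (Tmx (wfun kappa u) x) \in unitmx /\
        wedge_period (wedge kappa (cmx g *m V x) (cmx g *m V' x)) =
        moebius g (Tmx (wfun kappa u) x)].
  move=> Gg gl; have [c [c2 cV cV']] := loop_of_sign ufree GS u_continuation Gg gl.
  have mob : \forall x \near b,
    wedge kappa (cmx g *m V x) (cmx g *m V' x) 0 1 =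
        \det (automorphy_mx g (Tmx (wfun kappa u) x)) * wfun kappa u 0 1 x /\
    (wedge kappa (cmx g *m V x) (cmx g *m V' x) 0 1 != 0 ->
        automorphy_mx g (Tmx (wfun kappa u) x) \in unitmx /\
        wedge_period (wedge kappa (cmx g *m V x) (cmx g *m V' x)) =
        moebius g (Tmx (wfun kappa u) x)).
    apply: filterS (filterI w01_near u_wronskian) => x; rewrite TE wE => -[w01 w02].
    rewrite /moebius /automorphy_mx; apply: wedge_period_moebius => //.
      have := congr1 (fun y => kappa * y) w02; rewrite mulr0 mulrDr => <-.
      by rewrite -!(congr1 (fun f => f x) (wE _ _)).
    exact/Sp4_cmx/GS.
  split; [|by apply: filterS mob => x []|by apply: filterS mob => x []].
  move=> j m; rewrite wE.
  (* The loop acts by [c *: cmx g]; as [wedge] is bilinear and [c ^+ 2 = 1], the scalar drops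
     out. *)
  rewrite (_ : (fun x => wedge kappa (cmx g *m _) _ j m) =
    (fun x => wedge kappa ((c *: cmx g) *m V x) ((c *: cmx g) *m V' x) j m)).
    exact: (continuation_wedge kappa cV cV').
  have cE (v : 'cV[Cx R]_(2 + 2)) i : (c *: v) i 0 = c * v i 0 by rewrite mxE.
  apply/funext => x; rewrite /wedge -!scalemxAl !cE -[LHS]mul1r -c2; ring.
have TzetaK : \forall x \near b, zeta (Tmx (wfun kappa u) x 0 0) = x.
  by apply: filterS zetaK => x; rewrite mxE.
split.
- move=> g l Gg gl; have [cw _ mob] := key g l Gg gl.
  exists (fun j m x => wedge kappa (cmx g *m V x) (cmx g *m V' x) j m) => //.
(* Near [b] the composite with [T] is the identity, which continues to itself along every path; the
   zeroth power is [1] even at a zero determinant. *)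
- apply: (modular_form_of_continuation (f0 := id) GS TzetaK TzetaK) => g l _ _.
  exists id; first by apply: continuation_analytic; exact: has_pseries_id.
  by near=> x; rewrite expr0z mul1r.
- apply: (modular_form_of_continuation (f0 := wfun kappa u 0 1) GS TzetaK).
    by apply: filterS TzetaK => x ->.
  move=> g l Gg gl; have [cw w01 _] := key g l Gg gl.
  exists (fun x => wedge kappa (cmx g *m V x) (cmx g *m V' x) 0 1); first exact: cw.
  by apply: filterS w01 => x ->; rewrite expr1z.
Unshelve. all: by end_near. Qed.
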